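(* Let $B\in\mathcal{L}(\mathcal{K},\mathcal{H})$ and let $k\in\mathbb{C}$ be such that there exists $\varepsilon_0>0$ with $k\pm i\varepsilon\in\rho(A_B)$ for all $0<\varepsilon<\varepsilon_0$. Suppose there is a linear subspace $\mathfrak{H}\subseteq H$ such that $\mathfrak{H}\cap D(A^* )$ is dense in $H$ and (1) for every $f\in\mathrm{Ran}(\Gamma_1-B\Gamma_2)$ there is $F\in\mathfrak{H}\cap D(\widetilde{A}^* )$ satisfying $(\Gamma_1-B\Gamma_2)F=f$ and $u:=(\widetilde{A}^*-k)F\in\mathfrak{H}$; (2) $(\widetilde{\Gamma}_1-B^*\widetilde{\Gamma}_2)|_{\mathfrak{H}\cap D(A^* )}$ is surjective (onto $\mathcal{K}$); (3) $A^*v\in\mathfrak{H}$ for all $v\in\mathfrak{H}\cap D(A^* )$; (4) $\lim_{\varepsilon\to0}\big((A_B-(k\pm i\varepsilon))^{-1}w,v\big)_H$ exists (for each of the two signs, $\varepsilon\to 0$ through positive values) for all $w,v\in\mathfrak{H}$. Then for all $f\in\mathrm{Ran}(\Gamma_1-B\Gamma_2)$ the weak limits $M_B(k\pm i0)f:=\mathrm{w\text{-}}\lim_{\varepsilon\to0}M_B(k\pm i\varepsilon)f$ exist in $\mathcal{K}$. Moreover, for $f$ and $u$ as in (1), if $$\lim_{\varepsilon\to0}\big((A_B-(k+i\varepsilon))^{-1}u,v\big)_H=\lim_{\varepsilon\to0}\big((A_B-(k-i\varepsilon))^{-1}u,v\big)_H\quad\text{for all }v\in\mathfrak{H},$$ then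 $M_B(k+i0)f=M_B(k-i0)f$.
   Context: Setting: $H$ is a complex Hilbert space; $A$ and $\widetilde{A}$ are closed densely defined operators on $H$ forming an adjoint pair, i.e. $A^*\supseteq\widetilde{A}$ and $\widetilde{A}^*\supseteq A$. $D(\widetilde{A}^* )$ and $D(A^* )$ carry their graph norms. A boundary triplet for the pair is fixed: Hilbert spaces $\mathcal{H},\mathcal{K}$ and linear operators $\Gamma_1:D(\widetilde{A}^* )\to\mathcal{H}$, $\Gamma_2:D(\widetilde{A}^* )\to\mathcal{K}$, $\widetilde{\Gamma}_1:D(A^* )\to\mathcal{K}$, $\widetilde{\Gamma}_2:D(A^* )\to\mathcal{H}$, bounded with respect to the graph norms and surjective, such that for $u\in D(\widetilde{A}^* )$, $v\in D(A^* )$ $$(\widetilde{A}^*u,v)_H-(u,A^*v)_H=(\Gamma_1u,\widetilde{\Gamma}_2v)_{\mathcal{H}}-(\Gamma_2u,\widetilde{\Gamma}_1v)_{\mathcal{K}},$$ and $D(A)=D(\widetilde{A}^* )\cap\ker\Gamma_1\cap\ker\Gamma_2$, $D(\widetilde{A})=D(A^* )\cap\ker\widetilde{\Gamma}_1\cap\ker\widetilde{\Gamma}_2$. For $B\in\mathcal{L}(\mathcal{K},\mathcal{H})$ (bounded operators), $A_B:=\widetilde{A}^*|_{\ker(\Gamma_1-B\Gamma_2)}$. For $\lambda\in\rho(A_B)$ the $M$-function $M_B(\lambda):\mathrm{Ran}(\Gamma_1-B\Gamma_2)\to\mathcal{K}$ is the (well-defined) linear operator with $M_B(\lambda)(\Gamma_1-B\Gamma_2)u=\Gamma_2u$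 for all $u\in\ker(\widetilde{A}^*-\lambda)$. *)

(* Defs.v *)
From HB Require Import structures.
From mathcomp Require Import all_boot all_order all_algebra sesquilinear.
From mathcomp Require Import complex.
From mathcomp Require Import all_classical all_reals all_analysis.

Set Implicit Arguments.
Unset Strict Implicit.
Unset Printing Implicit Defensive.

Import Order.TTheory GRing.Theory Num.Theory numFieldNormedType.Exports.

Local Open Scope classical_set_scope.
Local Open Scope ring_scope.
Local Open Scope complex_scope.

(* The form is linear in its first argument and conjugate-linear in its
   second; `inner_norm` ties it to the norm, hence to the topology. *)
HB.mixin Record isHilbert (R : realType) H
    of CompleteNormedModule R[i] H := {
  inner : {dot H for (Num.conj : R[i] -> R[i])} ;
  inner_norm : forall u : H, inner u u = `|u| ^+ 2
}.

#[short(type="hilbertType")]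
HB.structure Definition Hilbert (R : realType) :=
  {H of isHilbert R H & CompleteNormedModule R[i] H}.

Notation "''[' u , v ]" := (inner u v) : ring_scope.

(* A partially defined operator; the values of `act` outside `dom` carry no
   meaning. *)
Record operator (U V : Type) := Operator {
  dom : set U ;
  act :> U -> V
}.
Arguments act {U V} o _ : simpl never.

Section Operators.
Variable R : realType.
Implicit Types U V : hilbertType R.

Definition linear_subspace U (D : set U) := submod_closed (mem D).

Definition linear_on U V (D : set U) (f : U -> V) :=
  linear_subspace D /\
  forall (a : R[i]) u v, D u -> D v -> f (a *: u + v) = a *: f u + f v.

Definition graph U V (T : operator U V) : set (U * V) :=
  [set p | dom T p.1 /\ p.2 = T p.1].

Definition closed_densely_defined U V (T : operator U V) :=
  [/\ linear_on (dom T) T, closed (graph T) & dense (dom T)].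

Definition extends U V (S T : operator U V) :=
  dom T `<=` dom S /\ {in dom T, S =1 T}.

Definition restrict U V (T : operator U V) (D : set U) : operator U V :=
  Operator (dom T `&` D) T.

Definition adjoint_values U V (T : operator U V) (v : V) : set U :=
  [set w | forall u, dom T u -> '[T u, v] = '[u, w]].

(* For densely defined `T` there is at most one adjoint value: `adjointE`. *)
Definition adjoint U V (T : operator U V) : operator V U :=
  Operator [set v | adjoint_values T v !=set0]
           (fun v => xget 0 (adjoint_values T v)).

Definition adjoint_pair U (A At : operator U U) :=
  extends (adjoint A) At /\ extends (adjoint At) A.

Definition graph_norm U V (T : operator U V) (u : U) : R[i] :=
  sqrtC (`|u| ^+ 2 + `|T u| ^+ 2).

Definition resolvent U (T : operator U U) (l : R[i]) : U -> U :=
  'pinv_(fun=> 0) (dom T) (fun u => T u - l *: u).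

Definition resolvent_set U (T : operator U U) : set R[i] :=
  [set l | set_bij (dom T) setT (fun u => T u - l *: u) /\
           exists M : R[i], forall w, `|resolvent T l w| <= M * `|w|].

Definition weak_cvg U (I : Type) (F : set_system I) (f : I -> U) (g : U) :=
  forall p : U, ('[f i, p] : R[i]^o) @[i --> F] --> ('[g, p] : R[i]^o).

(* Junk value 0 if there is no weak limit; otherwise see `weak_limE`. *)
Definition weak_lim U (I : Type) (F : set_system I) (f : I -> U) : U :=
  xget 0 [set g | weak_cvg F f g].

End Operators.

Section BoundaryTriplets.
Variable R : realType.
Variables H hh kk : hilbertType R.
Variables A At : operator H H.

(* `G` is a linear map from the domain of `T` onto `V`, bounded for the graph
   norm of `T`. *)
Definition bounded_surjection (V : hilbertType R) (T : operator H H)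
    (G : H -> V) :=
  [/\ linear_on (dom T) G,
      exists C : R[i], forall u, dom T u -> `|G u| <= C * graph_norm T u
    & set_surj (dom T) setT G].

(* The boundary operators are total functions whose values matter only on
   the domain of `adjoint At` (for Gamma1, Gamma2), respectively of `adjoint A`
   (for Gamma1t, Gamma2t, the ones written with a tilde). *)
Record boundary_triplet := BoundaryTriplet {
  Gamma1 : H -> hh ;
  Gamma2 : H -> kk ;
  Gamma1t : H -> kk ;
  Gamma2t : H -> hh ;
  Gamma1_surj : bounded_surjection (adjoint At) Gamma1 ;
  Gamma2_surj : bounded_surjection (adjoint At) Gamma2 ;
  Gamma1t_surj : bounded_surjection (adjoint A) Gamma1t ;
  Gamma2t_surj : bounded_surjection (adjoint A) Gamma2t ;
  green : forall u v, dom (adjoint At) u -> dom (adjoint A) v ->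
    '[adjoint At u, v] - '[u, adjoint A v] =
    '[Gamma1 u, Gamma2t v] - '[Gamma2 u, Gamma1t v] ;
  dom_min : dom A =
    dom (adjoint At) `&` Gamma1 @^-1` [set 0] `&` Gamma2 @^-1` [set 0] ;
  dom_mint : dom At =
    dom (adjoint A) `&` Gamma1t @^-1` [set 0] `&` Gamma2t @^-1` [set 0]
}.

Variable Gam : boundary_triplet.
Variable B : kk -> hh.

Definition bdry (u : H) : hh := Gamma1 Gam u - B (Gamma2 Gam u).

Definition bdryt (v : H) : kk :=
  Gamma1t Gam v - adjoint (Operator setT B) (Gamma2t Gam v).

Definition ran_bdry : set hh := bdry @` dom (adjoint At).

Definition op_bdry : operator H H :=
  restrict (adjoint At) (bdry @^-1` [set 0]).

(* For `l` in the resolvent set of `op_bdry` the set below is a singleton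
   whenever `f` is in `ran_bdry`: `M_functionE` and `M_function_dom`. *)
Definition M_function (l : R[i]) (f : hh) : kk :=
  xget 0 (Gamma2 Gam @`
    [set u | [/\ dom (adjoint At) u, adjoint At u = l *: u & bdry u = f]]).

End BoundaryTriplets.

Section Facts.
Variable R : realType.
Implicit Types U V : hilbertType R.

Lemma linear_onB U V (D : set U) (f : U -> V) u v :
  linear_on D f -> D u -> D v -> D (u - v) /\ f (u - v) = f u - f v.
Proof.
move=> [[_ sD] lf] Du Dv; rewrite addrC -scaleN1r; split.
  by have := sD (-1) v u; rewrite !in_setE => /(_ Dv Du).
by rewrite lf// scaleN1r addrC.
Qed.

Lemma linear_on0 U V (D : set U) (f : U -> V) :
  linear_on D f -> D 0 /\ f 0 = 0.
Proof.
move=> lf; have D0 : D 0 by case: lf => [[]]; rewrite in_setE.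
by split => //; have [_] := linear_onB lf D0 D0; rewrite !subrr.
Qed.

Lemma dense_ortho U (D : set U) (w : U) : dense D ->
  (forall u, D u -> '[u, w] = 0) -> w = 0.
Proof.
move=> dD Dw; apply/eqP/negPn/negP => w0.
have : (ball w `|w|) `&` D !=set0.
  apply: dD; last by apply: ball_open; rewrite normr_gt0.
  by exists w; apply: ballxx; rewrite normr_gt0.
case=> u []; rewrite -ball_normE/= => wu Du.
have : `|w - u| ^+ 2 < `|w| ^+ 2 by rewrite ltr_pXn2r ?nnegrE.
rewrite -!inner_norm dnormB.
have -> : '[w, u] = 0.
  by rewrite hermC/= expr0 mul1r Dw// rmorph0.
by rewrite rmorph0 addr0 subr0 gtrDl le_gtF ?dnorm_ge0.
Qed.

Lemma adjointE U V (T : operator U V) (v : V) (w : U) : dense (dom T) ->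
  adjoint_values T v w -> adjoint T v = w.
Proof.
move=> dT vw; apply: xget_unique => // w' vw'.
apply/eqP; rewrite -subr_eq0; apply/eqP/(dense_ortho dT) => u Tu.
by rewrite linearBr/= -vw// -vw'// subrr.
Qed.

Lemma adjointP U V (T : operator U V) (v : V) u :
  dom (adjoint T) v -> dom T u -> '[T u, v] = '[u, adjoint T v].
Proof. by move=> Tv Tu; exact: (xgetPex 0 Tv). Qed.

Lemma adjoint_linear U V (T : operator U V) : dense (dom T) ->
  linear_on (dom (adjoint T)) (adjoint T).
Proof.
move=> dT.
have lin a u v : dom (adjoint T) u -> dom (adjoint T) v ->
    adjoint_values T (a *: u + v) (a *: adjoint T u + adjoint T v).
  move=> Tu Tv z Tz.
  by rewrite !linearDr/= !linearZr_LR/= -!adjointP.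
split; last by move=> a u v Tu Tv; apply: adjointE => //; exact: lin.
split.
  by rewrite in_setE; exists 0 => u _; rewrite !linear0r.
move=> a u v; rewrite !in_setE => Tu Tv.
by exists (a *: adjoint T u + adjoint T v); exact: lin.
Qed.

Lemma weak_limE U (I : Type) (F : set_system I) (f : I -> U) (g : U) :
  ProperFilter F -> weak_cvg F f g -> weak_lim F f = g.
Proof.
move=> FF fg; apply: xget_unique => // g' fg'.
apply/eqP; rewrite -subr_eq0; apply/eqP.
apply: (@dense_ortho _ setT) => [W [z Wz] _|u _]; first by exists z.
rewrite hermC/= expr0 mul1r linearBl/=.
have -> : '[g', u] = '[g, u].
  exact: (cvg_unique (@norm_hausdorff _ R[i]^o) (fg' u) (fg u)).
by rewrite subrr rmorph0.
Qed.

Variables (H hh kk : hilbertType R) (A At : operator H H).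
Variables (Gam : boundary_triplet hh kk A At) (B : {linear kk -> hh}).

Lemma bdry_linear : linear_on (dom (adjoint At)) (bdry Gam B).
Proof.
have [[sD lG1] _ _] := Gamma1_surj Gam; have [[_ lG2] _ _] := Gamma2_surj Gam.
split=> // a u v Du Dv; rewrite /bdry lG1// lG2// linearP.
by rewrite scalerBr opprD addrACA.
Qed.

Lemma M_functionE l u : dense (dom At) ->
  resolvent_set (op_bdry Gam B) l -> dom (adjoint At) u ->
  adjoint At u = l *: u ->
  M_function Gam B l (bdry Gam B u) = Gamma2 Gam u.
Proof.
move=> dAt [[_ inj _] _] Du Atu; apply: xget_unique; first by exists u.
move=> g [v [Dv Atv uv] <-]; congr (Gamma2 Gam _).
have lAt := adjoint_linear dAt; have lb := bdry_linear.
have [D0 At0] := linear_on0 lAt; have [_ b0] := linear_on0 lb.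
have [Dvu Atvu] := linear_onB lAt Dv Du; have [_ bvu] := linear_onB lb Dv Du.
apply/eqP; rewrite -subr_eq0; apply/eqP/inj.
- by rewrite in_setE; split => //=; rewrite bvu uv subrr.
- by rewrite in_setE.
- rewrite /= -![act (op_bdry _ _) _]/(adjoint At _).
  by rewrite Atvu Atu Atv -scalerBr subrr At0 scaler0 subrr.
Qed.

Lemma M_function_dom l f : dense (dom At) ->
  resolvent_set (op_bdry Gam B) l -> ran_bdry Gam B f ->
  exists u, [/\ dom (adjoint At) u, adjoint At u = l *: u & bdry Gam B u = f].
Proof.
move=> dAt [[_ _ surj] _] [F DF <-].
have [v [Dv /= bv] vF] := surj (adjoint At F - l *: F) I.
have [DFv AtFv] := linear_onB (adjoint_linear dAt) DF Dv.
have [_ bFv] := linear_onB bdry_linear DF Dv.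
exists (F - v); split => //; last by rewrite bFv bv subr0.
move/eqP: vF; rewrite AtFv scalerBr subr_eq => /eqP ->.
by rewrite opprD opprB addrA [_ F + _]addrC subrK.
Qed.

End Facts.

(* Main.v *)
Require Import Defs.
From HB Require Import structures.
From mathcomp Require Import all_boot all_order all_algebra sesquilinear.
From mathcomp Require Import complex.
From mathcomp Require Import all_classical all_reals all_analysis.
From mathcomp Require Import ring lra.

(** The idea is to express [M_B(l) f] through the resolvent of [A_B], so that
the assumed limits of resolvent matrix elements become limits of matrix
elements of the M-function.

Let [f = (Gamma1 - B Gamma2) F] and [u = (adjoint At - k) F].  For [l = k + z] in
the resolvent set, with resolvent [R_l], the vector
[u_l = F - R_l u + z R_l F] is the solution of [(adjoint At - l) u_l = 0] with
[(Gamma1 - B Gamma2) u_l = f], so that [M_B(l) f = Gamma2 u_l].  Green's formula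
for [u_l] and a vector [v] of the domain of [adjoint A] reads
[[
  (M_B(l) f, (Gamma1t - adjoint B Gamma2t) v)
     = (f, Gamma2t v) - l (u_l, v) + (u_l, adjoint A v)
]]
([green_bdry], [M_function_inner]).  If [v] lies in the subspace [S], so does
[adjoint A v], and so do [F] and [u]; as [z] tends to 0 along [k +- i e], each
term on the right converges, and the term [z R_l F] disappears
([M_function_inner_cvg]).  Since [Gamma1t - adjoint B Gamma2t] maps these [v]
onto the whole space, [(M_B(l) f, p)] converges for every [p].  The limit depends on the
side from which [k] is approached only through the limits of [(R_l u, v)] and
[(R_l u, adjoint A v)], hence the second assertion.

A limit of [(M_B(l) f, p)] for each [p] is not yet a weak limit.  That one
exists is the sequential weak completeness of Hilbert spaces
([weak_cvg_exists]), which rests on the uniform boundedness principle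
([uniform_boundedness]) and the Riesz representation theorem ([riesz]).  The
latter also makes the adjoint of [B] everywhere defined
([adjoint_bounded_dom]), as Green's formula requires. *)

Set Implicit Arguments.
Unset Strict Implicit.
Unset Printing Implicit Defensive.

Import Order.TTheory GRing.Theory Num.Theory numFieldNormedType.Exports.

Local Open Scope classical_set_scope.
Local Open Scope ring_scope.
Local Open Scope complex_scope.

(** * The real-valued norm and the Cauchy-Schwarz inequality *)

Section RealNorm.
Variables (R : realType) (U : hilbertType R).
Implicit Types (x y z : U) (c t : R[i]).

(** Norms take their values in [R[i]], whose order is only partial.  Their real
parts lie in a totally ordered field, where suprema exist and estimates can be
compared. *)
Definition rnorm (V : normedZmodType R[i]) (x : V) : R := complex.Re `|x|.

Lemma rnormE (V : normedZmodType R[i]) (x : V) : `|x| = (rnorm x)%:C.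
Proof. by rewrite /rnorm RRe_real ?normr_real. Qed.

Lemma rnorm_ge0 (V : normedZmodType R[i]) (x : V) : 0 <= rnorm x.
Proof. by rewrite -ler0c -rnormE. Qed.

Lemma rnormD (V : normedZmodType R[i]) (x y : V) :
  rnorm (x + y) <= rnorm x + rnorm y.
Proof. by rewrite -lecR rmorphD/= -!rnormE ler_normD. Qed.

Lemma rnormN (V : normedZmodType R[i]) (x : V) : rnorm (- x) = rnorm x.
Proof. by rewrite /rnorm normrN. Qed.

Lemma rnormM c t : rnorm (c * t) = rnorm c * rnorm t.
Proof. by apply: complexI; rewrite rmorphM/= -!rnormE normrM. Qed.

Lemma rnormZ c x : rnorm (c *: x) = rnorm c * rnorm x.
Proof. by apply: complexI; rewrite rmorphM/= -!rnormE normrZ. Qed.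

Lemma rnorm_real (r : R) : 0 <= r -> rnorm r%:C = r.
Proof. by move=> r0; rewrite /rnorm ger0_norm ?ler0c. Qed.

Lemma ge_Re_rnorm c : `|complex.Re c| <= rnorm c.
Proof. by rewrite -lecR -rnormE normc_ge_Re. Qed.

Lemma rnorm_conj c : rnorm (Num.conj c) = rnorm c.
Proof. by rewrite /rnorm norm_conjC. Qed.

Lemma mulJ_rnorm c : Num.conj c * c = (rnorm c ^+ 2)%:C.
Proof. by rewrite mulrC -normCK rnormE rmorphXn. Qed.

Lemma innerJ x y : '[x, y] = Num.conj '[y, x].
Proof. by rewrite hermC/= expr0 mul1r. Qed.

Lemma rnorm_inner x : '[x, x] = (rnorm x ^+ 2)%:C.
Proof. by rewrite inner_norm rnormE rmorphXn. Qed.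

Lemma rnormD_sqr x y :
  rnorm (x + y) ^+ 2 = rnorm x ^+ 2 + rnorm y ^+ 2 + 2 * complex.Re '[y, x].
Proof.
apply: complexI; rewrite -rnorm_inner dnormD !rnorm_inner !rmorphD/=.
congr (_ + _); rewrite (innerJ x y) conjCK addrC.
by have := addcJ '[y, x]; rewrite rmorphM => ->; rewrite rmorph_nat.
Qed.

(** The discriminant inequality for a nonnegative quadratic polynomial on the
complex plane.  It yields both the Cauchy-Schwarz inequality and, in the proof
of [riesz], the approximate Euler-Lagrange equation of a near-minimiser. *)
Lemma rnorm_le_of_quadratic (a n : R) c : 0 <= a -> 0 <= n ->
  (forall t, 0 <= a ^+ 2 + rnorm t ^+ 2 * n ^+ 2 + 2 * complex.Re (t * c)) ->
  rnorm c <= a * n.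
Proof.
move=> a0 n0 q; set r := rnorm c; have r0 : 0 <= r := rnorm_ge0 c.
(* Along the ray [t = - T c^*] the linear term is as negative as possible. *)
have {}q T : 0 <= T -> 0 <= a ^+ 2 + T ^+ 2 * r ^+ 2 * n ^+ 2 - 2 * T * r ^+ 2.
  move=> T0; have := q (- (T%:C * Num.conj c)).
  rewrite rnormN rnormM rnorm_conj mulNr -[_ * _ * c]mulrA mulJ_rnorm -rmorphM raddfN/=
    mulrN.
  by rewrite rnorm_real// exprMn [2 * (_ * _)]mulrA.
have [n00|n00] := eqVneq n 0.
  (* The polynomial is affine; this [T] makes it negative unless [c] is 0. *)
  rewrite n00 mulr0 leNgt; apply/negP => rgt.
  have r2 : 0 < r ^+ 2 by rewrite exprn_gt0.
  have := q ((a ^+ 2 + 1) / r ^+ 2) (divr_ge0 (addr_ge0 (sqr_ge0 _) ler01) (ltW r2)).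
  by rewrite n00 expr0n mulr0 addr0 -mulrA divfK ?gt_eqF//; nra.
have n2 : 0 < n ^+ 2 by rewrite exprn_gt0// lt_def n00.
(* The minimum of the polynomial in [T] is at [1 / n ^+ 2]. *)
have := q (n ^+ 2)^-1 (ltW (_ : 0 < _)); rewrite invr_gt0 => /(_ n2).
rewrite (_ : _ - _ = a ^+ 2 - r ^+ 2 / n ^+ 2); last by field.
rewrite subr_ge0 ler_pdivrMr// -exprMn ler_pXn2r// nnegrE//.
exact: mulr_ge0.
Qed.

Lemma CauchySchwarz_rnorm x y : rnorm '[x, y] <= rnorm x * rnorm y.
Proof.
rewrite mulrC; apply: rnorm_le_of_quadratic; rewrite ?rnorm_ge0// => t.
have := sqr_ge0 (rnorm (y + t *: x)); rewrite rnormD_sqr rnormZ exprMn.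
by rewrite [in '[_, y]]linearZl_LR.
Qed.

(** * Completeness, Riesz representation and uniform boundedness *)

Lemma geometric_lt (q r : R) : 0 <= q < 1 -> 0 < r -> exists n, q ^+ n < r.
Proof.
move=> /andP[q0 q1] r0; have : geometric 1 q @ \oo --> (0 : R).
  by apply: cvg_geometric; rewrite ger0_norm.
move=> /cvgrPdist_lt /(_ _ r0)[n _ /(_ n (leqnn n))] /=.
by rewrite sub0r normrN /= mul1r ger0_norm ?exprn_ge0// => ?; exists n.
Qed.

(** Completeness in quantitative form: the limit inherits the a priori error
bounds [b], which is what the two constructions below exploit. *)
Lemma rnorm_cauchy (x : nat -> U) (b : nat -> R) :
  (forall r : R, 0 < r -> exists n, b n < r) ->
  (forall m n, (n <= m)%N -> rnorm (x m - x n) <= b n) ->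
  exists l, forall n, rnorm (l - x n) <= b n.
Proof.
move=> b0 xb.
have : cvg (x @ \oo).
  apply: cauchy_cvg; apply: cauchy_exP => e e0.
  have eE : e = (complex.Re e)%:C by rewrite RRe_real ?gtr0_real.
  have [|n bn] := b0 (complex.Re e); first by rewrite -ltcR -eE.
  exists (x n), n => // m /= nm; rewrite -ball_normE /= distrC eE rnormE ltcR.
  by rewrite (le_lt_trans (xb _ _ nm)).
case/cvg_ex => l /cvgrPdist_lt xl; exists l => n.
apply/ler_addgt0Pr => e e0.
have [|m _ lm] := xl e%:C; first by rewrite ltcR.
have := lm (maxn m n) (leq_maxl _ _).
have := xb _ _ (leq_maxr m n).
rewrite /= rnormE ltcR => h1 /ltW h2.
rewrite (_ : l - x n = (x (maxn m n) - x n) + (l - x (maxn m n))).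
  by rewrite (le_trans (rnormD _ _))// lerD.
by rewrite [RHS]addrC subrKA.
Qed.

(** The representing vector minimises [J x = |x|^2 - 2 Re (phi x)].  Comparing
[J x] with [J (x + t y)] for all complex [t] shows that a vector [x] where [J]
is within [d^2] of its infimum satisfies [|(y, x) - phi y| <= d |y|] for all [y].
Two such vectors with tolerances [d] and [d'] are thus at distance at most
[d + d'], so near-minimisers form a Cauchy sequence, and the estimate passes to
its limit. *)
Lemma riesz (phi : U -> R[i]) (C : R) :
  (forall a x y, phi (a *: x + y) = a * phi x + phi y) ->
  (forall x, rnorm (phi x) <= C * rnorm x) ->
  exists g, forall x, phi x = '[x, g].
Proof.
move=> lphi bphi.
pose J x := rnorm x ^+ 2 - 2 * complex.Re (phi x).
have infJ : has_inf (range J).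
  split; first by exists (J 0), 0.
  exists (- C ^+ 2) => _ [x _ <-]; rewrite /J.
  have := bphi x; have := ge_Re_rnorm (phi x); rewrite ler_norml => /andP[_].
  have := sqr_ge0 (rnorm x - C); rewrite sqrrB.
  by lra.
have near_min n : exists x, forall y,
    rnorm ('[y, x] - phi y) <= 2^-1 ^+ n * rnorm y.
  have e0 : 0 < (2^-1 ^+ n : R) by rewrite exprn_gt0// invr_gt0.
  have [|_ [x _ <-] xm] := inf_adherent (_ : 0 < (2^-1 ^+ n : R) ^+ 2) infJ.
    by rewrite exprn_gt0.
  exists x => y; apply: rnorm_le_of_quadratic; rewrite ?rnorm_ge0 ?ltW// => t.
  have := ge_inf (proj2 infJ) (imageT J (t *: y + x)).
  rewrite [X in _ <= X]/J lphi [t *: y + x]addrC rnormD_sqr rnormZ raddfD/=.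
  rewrite linearZl_LR/= => h.
  rewrite (_ : complex.Re _ = complex.Re (t * '[y, x]) - complex.Re (t * phi y)).
    by move: xm h; rewrite /J exprMn; lra.
  by rewrite mulrBr raddfB.
have [x xP] := choice near_min.
have close m n : (n <= m)%N -> rnorm (x m - x n) <= 2 * 2^-1 ^+ n.
  move=> nm; set d := x m - x n.
  have [->|d0] := eqVneq (rnorm d) 0; first by rewrite mulr_ge0// exprn_ge0// invr_ge0.
  have dgt : 0 < rnorm d by rewrite lt_def d0 rnorm_ge0.
  have dE : '[d, d] = ('[d, x m] - phi d) - ('[d, x n] - phi d).
    by rewrite opprB [phi d - _]addrC addrACA addNr addr0 -linearBr.
  rewrite -(ler_pM2r dgt) -expr2 -(rnorm_real (sqr_ge0 _)) -rnorm_inner dE.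
  have mn : (2^-1 : R) ^+ m <= 2^-1 ^+ n.
    by apply: ler_wiXn2l => //; rewrite ?invr_ge0 ?invf_le1 ?ler1n.
  have h1 := xP m d; have h2 := xP n d.
  apply: le_trans (rnormD _ _) _; rewrite rnormN.
  by nra.
have [|l lP] := rnorm_cauchy _ close.
  move=> r r0; have [||n nr] := @geometric_lt 2^-1 (r / 2); [lra|lra|].
  by exists n; rewrite mulrC -ltr_pdivlMr.
exists l => y; apply/eqP; rewrite eq_sym -subr_eq0; apply/eqP.
apply: normr0_eq0; rewrite rnormE; congr (_%:C); apply/eqP.
rewrite eq_le rnorm_ge0 andbT; apply/ler_addgt0Pr => e e0; rewrite add0r.
have p0 : 0 < 3 * (rnorm y + 1) by rewrite mulr_gt0// ltr_wpDl// rnorm_ge0.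
have [||n ne] := @geometric_lt 2^-1 (e / (3 * (rnorm y + 1))).
- by lra.
- by rewrite divr_gt0.
move: ne; rewrite ltr_pdivlMr// => ne.
rewrite (_ : _ - _ = '[y, l - x n] + ('[y, x n] - phi y)); last first.
  by rewrite linearBr/= addrA subrK.
apply: le_trans (rnormD _ _) _.
have h1 := CauchySchwarz_rnorm y (l - x n); have h2 := lP n; have h3 := xP n y.
have h4 := rnorm_ge0 y.
have h5 : rnorm y * rnorm (l - x n) <= rnorm y * (2 * 2^-1 ^+ n) by rewrite ler_wpM2l.
have h6 : 0 <= (2^-1 : R) ^+ n by rewrite exprn_ge0// invr_ge0.
by nra.
Qed.

(** One of the two points [p + h] and [p - h], with [h] of norm [r] in the
direction of [y], will do: the values of [(y, .)] at these points differ by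
[2 r |y|]. *)
Lemma exists_inner_ge (y p : U) (r : R) : 0 <= r ->
  exists q, rnorm (q - p) <= r /\ r * rnorm y <= rnorm '[y, q].
Proof.
move=> r0; have [y0|y0] := eqVneq (rnorm y) 0.
  by exists p; rewrite subrr y0 mulr0 rnorm_ge0 /rnorm normr0.
have ygt : 0 < rnorm y by rewrite lt_def y0 rnorm_ge0.
pose h := (r / rnorm y)%:C *: y.
have hr : rnorm h = r.
  by rewrite rnormZ rnorm_real ?divfK// divr_ge0// ltW.
have yh : rnorm '[y, h] = r * rnorm y.
  rewrite innerJ rnorm_conj linearZl_LR/= rnorm_inner -rmorphM/= rnorm_real.
    by rewrite expr2 mulrA divfK.
  by rewrite mulr_ge0 ?sqr_ge0// divr_ge0// ltW.
have [le|lt] := leP (r * rnorm y) (rnorm '[y, p + h]).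
  by exists (p + h); rewrite addrC addKr hr.
exists (p - h); split; first by rewrite addrC addKr rnormN hr.
have : rnorm ('[y, p + h] - '[y, p - h]) = 2 * (r * rnorm y).
  rewrite -linearBr/= opprD opprK addrACA subrr add0r linearDr/= -mulr2n.
  rewrite -[X in rnorm X]mulr_natl rnormM yh.
  by rewrite -[in LHS](rmorph_nat (real_complex R)) rnorm_real.
have := rnormD '[y, p + h] (- '[y, p - h]); rewrite rnormN.
by lra.
Qed.

(** A gliding hump argument, which needs completeness but no category argument.
If the norms were unbounded, one could select [y_n = x (k n)] with
[|y_n| > n 3^n] and, by [exists_inner_ge], points [p n] with
[|p (n+1) - p n| <= 3^-n] and [|(y_n, p (n+1))| >= 3^-n |y_n|].  The limit [l] of
[p] is within [3^-n / 2] of [p (n+1)], so that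
[|(y_n, l)| >= 3^-n |y_n| / 2 > n / 2], which contradicts boundedness at [l]. *)
Lemma uniform_boundedness (x : nat -> U) :
  (forall p, exists C : R, forall n, rnorm '[x n, p] <= C) ->
  exists C : R, forall n, rnorm (x n) <= C.
Proof.
move=> bx; apply: contrapT => unb.
have large n : exists k, n%:R * 3 ^+ n < rnorm (x k).
  apply: contrapT => nk; apply: unb; exists (n%:R * 3 ^+ n) => k.
  by rewrite leNgt; apply/negP => ?; apply: nk; exists k.
have [k kP] := choice large.
have e_gt0 n : 0 < (3^-1 : R) ^+ n by rewrite exprn_gt0// invr_gt0.
have step (np : nat * U) : exists q, rnorm (q - np.2) <= 3^-1 ^+ np.1 /\
    3^-1 ^+ np.1 * rnorm (x (k np.1)) <= rnorm '[x (k np.1), q].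
  exact/exists_inner_ge/ltW.
have [next nextP] := choice step.
pose p := fix p n := if n is m.+1 then next (m, p m) else 0.
have close n j :
    rnorm (p (n + j)%N - p n) <= 3 / 2 * (3^-1 ^+ n - 3^-1 ^+ (n + j)%N).
  elim: j => [|j IHj]; first by rewrite addn0 !subrr mulr0 /rnorm normr0.
  rewrite addnS exprS /= -[_ - p n](subrKA (p (n + j)%N)).
  have [/= h _] := nextP ((n + j)%N, p (n + j)%N).
  by apply: le_trans (rnormD _ _) _; lra.
have [||l lP] := @rnorm_cauchy p (fun n => 3 / 2 * 3^-1 ^+ n).
- move=> r r0; have [||n nr] := @geometric_lt 3^-1 (2 / 3 * r); [lra|lra|].
  by exists n; lra.
- move=> m n nm; have := close n (m - n)%N; rewrite subnKC//.
  by have := e_gt0 m; lra.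
have [C CP] := bx l.
have [n nC] : exists n : nat, 2 * C < n%:R.
  by exists (Num.truncn (2 * C)).+1; rewrite truncnS_gt.
have [/= _ h1] := nextP (n, p n).
have h2 := lP n.+1; have h3 := CP (k n).
have h4 := CauchySchwarz_rnorm (x (k n)) (l - p n.+1).
have h5 := rnormD '[x (k n), l] (- '[x (k n), l - p n.+1]).
have h6 := rnorm_ge0 (x (k n)).
have h7 : n%:R < 3^-1 ^+ n * rnorm (x (k n)).
  rewrite -ltr_pdivrMl//; apply: le_lt_trans (kP n).
  by rewrite exprVn invrK mulrC.
have h8 : rnorm (x (k n)) * rnorm (l - p n.+1) <=
    rnorm (x (k n)) * (3 / 2 * 3^-1 ^+ n.+1) by rewrite ler_wpM2l.
move: h5; rewrite rnormN -linearBr/= subKr => h5.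
move: h8; rewrite exprS => h8.
by move: h1 => /=; lra.
Qed.

End RealNorm.

(** * Weak sequential completeness *)

Section WeakCompleteness.
Variables (R : realType) (U : hilbertType R).

Lemma rnorm_cvg_le (I : Type) (F : set_system I) (a : I -> R[i]^o) (l : R[i]^o)
    (M : R) : ProperFilter F ->
  a i @[i --> F] --> l -> (forall i, rnorm (a i) <= M) -> rnorm l <= M.
Proof.
move=> FF al aM; apply/ler_addgt0Pr => e e0.
have /cvgrPdist_lt/(_ e%:C) := al; rewrite ltcR => /(_ e0) near_l.
have [j] := filter_ex near_l.
rewrite rnormE ltcR => /ltW lai.
rewrite -[l](subrK (a j)); apply: le_trans (rnormD _ _) _.
by rewrite addrC lerD.
Qed.

(** The limit functional is bounded by uniform boundedness along the sequence
[s], hence represented by a vector.  The sequence is essential: along a filter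
without a countable cofinal part, the limit functional may be unbounded. *)
Lemma weak_cvg_exists (I : Type) (F : set_system I) (s : nat -> I)
    (f : I -> U) : ProperFilter F -> s n @[n --> \oo] --> F ->
  (forall p, cvg (('[f i, p] : R[i]^o) @[i --> F])) ->
  exists g, weak_cvg F f g.
Proof.
move=> FF sF fcvg.
pose phi p : R[i]^o := lim (('[f i, p] : R[i]^o) @[i --> F]).
have phiP p : ('[f i, p] : R[i]^o) @[i --> F] --> phi p by exact: fcvg.
have phis p : ('[f (s n), p] : R[i]^o) @[n --> \oo] --> phi p.
  exact: cvg_comp sF (phiP p).
have [C fC] : exists C : R, forall n, rnorm (f (s n)) <= C.
  apply: uniform_boundedness => p.
  have /cvg_seq_bounded/pinfty_ex_gt0[M M0 fM] := cvgP _ (phis p).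
  by exists (rnorm M) => n; rewrite -lecR -!rnormE (gtr0_norm M0); exact: fM.
(* [phi] is conjugate-linear, its conjugate is linear. *)
have [a x y||g gP] := @riesz _ _ (fun p => Num.conj (phi p)) C.
- have phiD : (Num.conj a * '[f i, x] + '[f i, y] : R[i]^o) @[i --> F] -->
      (Num.conj a * phi x + phi y : R[i]^o).
    by apply: cvgD (phiP y); apply: cvgMl_tmp; exact: phiP.
  have -> : phi (a *: x + y) = Num.conj a * phi x + phi y.
    apply: cvg_unique (phiP _) _; first exact: norm_hausdorff.
    apply: cvg_trans phiD; apply: near_eq_cvg; apply: nearW => j.
    by rewrite /= linearDr/= linearZr_LR.
  by rewrite rmorphD rmorphM/= conjCK.
- move=> x; rewrite rnorm_conj; apply: rnorm_cvg_le (phis x) _ => n.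
  by rewrite (le_trans (CauchySchwarz_rnorm _ _))// ler_wpM2r// rnorm_ge0.
exists g => p; rewrite (_ : '[g, p] = phi p)//.
by rewrite innerJ -gP conjCK.
Qed.

End WeakCompleteness.

(** * Bounded adjoints and resolvents *)

Lemma adjoint_bounded_dom (R : realType) (U V : hilbertType R)
    (B : {linear U -> V}) : continuous B ->
  dom (adjoint (Operator setT B)) = setT.
Proof.
move=> cB; apply/seteqP; split => // q _.
have cB0 : {for 0, continuous B} by exact: cB.
have /linear_boundedP/pinfty_ex_gt0[r r0 Br] :=
  continuous_linear_bounded 0 cB0.
have [a x y|x|g gP] := @riesz _ _ (fun p => '[B p, q]) (rnorm r * rnorm q).
- by rewrite linearP linearDl/= linearZl_LR.
- rewrite (le_trans (CauchySchwarz_rnorm _ _))// mulrAC ler_wpM2r ?rnorm_ge0//.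
  rewrite -lecR rmorphM/= -!rnormE (gtr0_norm r0); exact: Br.
- by exists g => u _; rewrite -gP.
Qed.

Lemma resolventP (R : realType) (U : hilbertType R) (T : operator U U)
    (l : R[i]) (w : U) : resolvent_set T l ->
  dom T (resolvent T l w) /\
  T (resolvent T l w) - l *: resolvent T l w = w.
Proof.
move=> [bij _]; rewrite /resolvent; split.
  by have [+ _ _] := bijpinv_bij (fun=> 0) bij; apply.
have [_ _ surj] := bij.
by apply: (surjpK (fun=> 0) surj); rewrite inE.
Qed.

Lemma linear_onP (R : realType) (U V : hilbertType R) (D : set U) (f : U -> V)
    (a : R[i]) u v : linear_on D f -> D u -> D v ->
  D (a *: u + v) /\ f (a *: u + v) = a *: f u + f v.
Proof.
move=> [[_ sD] lf] Du Dv; split; last exact: lf.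
by have := sD a u v; rewrite !in_setE; exact.
Qed.

Lemma harmonic_at_right (R : realType) :
  (harmonic n : R) @[n --> \oo] --> (0 : R)^'+.
Proof.
move=> P /(@cvg_harmonic R)[n _ nP]; exists n => // m nm.
exact: nP (harmonic_gt0 m).
Qed.

(** * The M-function in terms of the resolvent *)

Section BoundaryValues.
Variables (R : realType) (H hh kk : hilbertType R) (A At : operator H H).
Variables (Gam : boundary_triplet hh kk A At) (B : {linear kk -> hh}).
Hypotheses (dAt : dense (dom At)) (cB : continuous B).

(** Green's formula with the boundary operators [Gamma1 - B Gamma2] and
[Gamma1t - adjoint B Gamma2t]: the terms [(B Gamma2 u, Gamma2t v)] and
[(Gamma2 u, adjoint B Gamma2t v)] cancel. *)
Lemma green_bdry u v : dom (adjoint At) u -> dom (adjoint A) v ->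
  '[Gamma2 Gam u, bdryt Gam B v] =
  '[bdry Gam B u, Gamma2t Gam v] - ('[adjoint At u, v] - '[u, adjoint A v]).
Proof.
move=> Du Dv; rewrite (green Gam Du Dv) /bdry /bdryt linearBr linearBl/=.
have -> : '[B (Gamma2 Gam u), Gamma2t Gam v] =
    '[Gamma2 Gam u, adjoint (Operator setT B) (Gamma2t Gam v)].
  apply: (@adjointP _ _ _ (Operator setT B)) => //.
  by rewrite adjoint_bounded_dom.
by ring.
Qed.

(** Only [F] and [adjoint At F - k F] occur under the resolvent at [k + z].  Using
[(adjoint At - (k + z)) F] directly would involve a vector that varies with [z],
whereas the limits of the resolvent are known on fixed vectors only. *)
Lemma M_function_inner (k z : R[i]) F v : resolvent_set (op_bdry Gam B) (k + z) ->
  dom (adjoint At) F -> dom (adjoint A) v ->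
  let r w := resolvent (op_bdry Gam B) (k + z) w in
  let p x := (k + z) * '[x, v] - '[x, adjoint A v] in
  '[M_function Gam B (k + z) (bdry Gam B F), bdryt Gam B v] =
  '[bdry Gam B F, Gamma2t Gam v]
  - (p F - p (r (adjoint At F - k *: F)) + z * p (r F)).
Proof.
move=> rho DF Dv r p; have lAt := adjoint_linear dAt.
have lb := bdry_linear Gam B; set u := adjoint At F - k *: F.
have [[Du bu] ru] := resolventP u rho; have [[DrF brF] rrF] := resolventP F rho.
have [DFu AFu] := linear_onB lAt DF Du; have [_ bFu] := linear_onB lb DF Du.
(* The element of the kernel of [adjoint At - (k + z)] with the boundary
   value of [F]. *)
set x := z *: r F + (F - r u).
have [Dx Ax] := linear_onP z lAt DrF DFu.
have [_ bx] := linear_onP z lb DrF DFu.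
have {}Ax : adjoint At x = (k + z) *: x.
  rewrite Ax AFu; move/eqP: ru; move/eqP: rrF.
  rewrite -![act (op_bdry _ _) _]/(adjoint At _).
  rewrite !subr_eq => /eqP -> /eqP ->.
  rewrite /x -/(r F) -/(r u) [- (u + _)]opprD [adjoint At F + _]addrA {1}/u subKr.
  rewrite !scalerDr scalerN !scalerA [z * _]mulrC [(k + z) *: F]scalerDl.
  by rewrite [z *: F + _]addrC -addrA; congr (_ + _); rewrite addrA [z *: F + _]addrC.
have {}bx : bdry Gam B x = bdry Gam B F.
  by rewrite bx bFu brF bu scaler0 add0r subr0.
rewrite -bx M_functionE// green_bdry// Ax linearZl_LR/= bx; congr (_ - _).
rewrite /p /x !linearPl/= !linearBl/=.
by ring.
Qed.

(** * Limits at the point k *)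

(** The approach to [k] is along [k + s e] with [e] decreasing to 0; the theorem
uses [s = i] and [s = - i]. *)
Section OneSide.
Variables (S : set H) (k s : R[i]).
Hypotheses
  (rho : \forall e \near (0 : R)^'+,
     resolvent_set (op_bdry Gam B) (k + s * e%:C))
  (SA : forall v, S v -> dom (adjoint A) v -> S (adjoint A v))
  (lims : forall w v, S w -> S v ->
     cvg (('[resolvent (op_bdry Gam B) (k + s * e%:C) w, v] : R[i]^o)
            @[e --> 0^'+])).

Let L w v : R[i]^o :=
  lim (('[resolvent (op_bdry Gam B) (k + s * e%:C) w, v] : R[i]^o)
         @[e --> 0^'+]).

(** The resolvent itself need not stay bounded near [k]: the term with
[z = s e] tends to 0 because its matrix elements converge, [F] being in [S]. *)
Lemma M_function_inner_cvg F v :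
  let u := adjoint At F - k *: F in
  S F -> dom (adjoint At) F -> S u -> S v -> dom (adjoint A) v ->
  ('[M_function Gam B (k + s * e%:C) (bdry Gam B F), bdryt Gam B v] : R[i]^o)
    @[e --> 0^'+] -->
  ('[bdry Gam B F, Gamma2t Gam v] -
   (k * '[F, v] - '[F, adjoint A v] - (k * L u v - L u (adjoint A v))) : R[i]^o).
Proof.
move=> u SF DF Su Sv Dv; have SAv := SA Sv Dv.
have [cu cu'] := (lims Su Sv, lims Su SAv).
have [cF cF'] := (lims SF Sv, lims SF SAv).
pose r (e : R) w := resolvent (op_bdry Gam B) (k + s * e%:C) w.
have se0 : (s * e%:C : R[i]^o) @[e --> 0^'+] --> (0 : R[i]^o).
  rewrite -[X in _ --> X](mulr0 s); apply: cvgMl_tmp.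
  apply/cvgrPdist_lt => d d0.
  have dE : d = (complex.Re d)%:C by rewrite RRe_real ?gtr0_real.
  have : 0 < complex.Re d by rewrite -ltcR -dE.
  move=> /nbhs_right_lt; apply: filterS2 (nbhs_right_gt 0) => e e0 ed.
  by rewrite sub0r normrN rnormE rnorm_real ?ltW// dE ltcR.
have ke : (k + s * e%:C : R[i]^o) @[e --> 0^'+] --> (k : R[i]^o).
  by rewrite -[X in _ --> X](addr0 k); apply: cvgD se0; exact: cvg_cst.
pose p (e : R) x := (k + s * e%:C) * '[x, v] - '[x, adjoint A v].
have pF : (p e F : R[i]^o) @[e --> 0^'+] -->
    (k * '[F, v] - '[F, adjoint A v] : R[i]^o).
  by apply: cvgB; [apply: cvgM ke _; exact: cvg_cst | exact: cvg_cst].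
have pu : (p e (r e u) : R[i]^o) @[e --> 0^'+] -->
    (k * L u v - L u (adjoint A v) : R[i]^o).
  by apply: cvgB cu'; exact: cvgM ke cu.
have pr : (s * e%:C * p e (r e F) : R[i]^o) @[e --> 0^'+] --> (0 : R[i]^o).
  rewrite -[X in _ --> X](mul0r (k * L F v - L F (adjoint A v))).
  by apply: cvgM se0 _; apply: cvgB cF'; exact: cvgM ke cF.
have lim : ('[bdry Gam B F, Gamma2t Gam v] -
    (p e F - p e (r e u) + s * e%:C * p e (r e F)) : R[i]^o) @[e --> 0^'+] -->
  ('[bdry Gam B F, Gamma2t Gam v] -
   (k * '[F, v] - '[F, adjoint A v] - (k * L u v - L u (adjoint A v)) + 0)
     : R[i]^o).
  by apply: cvgB; [exact: cvg_cst | apply: cvgD pr; exact: cvgB pF pu].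
rewrite addr0 in lim; apply: cvg_trans lim; apply: near_eq_cvg.
by apply: filterS rho => e rhoe; rewrite M_function_inner.
Qed.

Lemma M_function_weak_cvg f :
  set_surj (S `&` dom (adjoint A)) setT (bdryt Gam B) ->
  (exists F, [/\ S F, dom (adjoint At) F, bdry Gam B F = f
     & S (adjoint At F - k *: F)]) ->
  exists g, weak_cvg 0^'+ (fun e : R => M_function Gam B (k + s * e%:C) f) g.
Proof.
move=> surj [F [SF DF <- Su]].
apply: (weak_cvg_exists _ (@harmonic_at_right R)) => p.
have [v [Sv Dv] <-] := surj p I.
by apply: cvgP; exact: M_function_inner_cvg.
Qed.

End OneSide.

End BoundaryValues.

Theorem theorem5p1 (R : realType) (H hh kk : hilbertType R)
    (A At : operator H H)
    (hA : closed_densely_defined A) (hAt : closed_densely_defined At)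
    (hAAt : adjoint_pair A At)
    (Gam : boundary_triplet hh kk A At)
    (B : {linear kk -> hh}) (hB : continuous B)
    (k : R[i])
    (hk : exists2 e0 : R, 0 < e0 & forall e : R, 0 < e -> e < e0 ->
      resolvent_set (op_bdry Gam B) (k + 'i * e%:C) /\
      resolvent_set (op_bdry Gam B) (k - 'i * e%:C))
    (S : set H) (hS : linear_subspace S)
    (hSd : dense (S `&` dom (adjoint A)))
    (h1 : forall f, ran_bdry Gam B f ->
      exists F, [/\ S F, dom (adjoint At) F, bdry Gam B F = f
        & S (adjoint At F - k *: F)])
    (h2 : set_surj (S `&` dom (adjoint A)) setT (bdryt Gam B))
    (h3 : forall v, S v -> dom (adjoint A) v -> S (adjoint A v))
    (h4 : forall w v, S w -> S v ->
      cvg (('[resolvent (op_bdry Gam B) (k + 'i * e%:C) w, v] : R[i]^o)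
             @[e --> 0^'+]) /\
      cvg (('[resolvent (op_bdry Gam B) (k - 'i * e%:C) w, v] : R[i]^o)
             @[e --> 0^'+])) :
  (forall f, ran_bdry Gam B f ->
    (exists g : kk, weak_cvg 0^'+
       (fun e : R => M_function Gam B (k + 'i * e%:C) f) g) /\
    (exists g : kk, weak_cvg 0^'+
       (fun e : R => M_function Gam B (k - 'i * e%:C) f) g)) /\
  (forall f F u, ran_bdry Gam B f ->
    S F -> dom (adjoint At) F -> bdry Gam B F = f ->
    u = adjoint At F - k *: F -> S u ->
    (forall v, S v ->
      lim (('[resolvent (op_bdry Gam B) (k + 'i * e%:C) u, v] : R[i]^o)
             @[e --> 0^'+]) =
      lim (('[resolvent (op_bdry Gam B) (k - 'i * e%:C) u, v] : R[i]^o)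
             @[e --> 0^'+])) ->
    weak_lim 0^'+ (fun e : R => M_function Gam B (k + 'i * e%:C) f) =
    weak_lim 0^'+ (fun e : R => M_function Gam B (k - 'i * e%:C) f)).
Proof.
have [_ _ dAt] := hAt.
have [rhoP rhoN] : (\forall e \near (0 : R)^'+,
    resolvent_set (op_bdry Gam B) (k + 'i * e%:C)) /\
    (\forall e \near (0 : R)^'+,
    resolvent_set (op_bdry Gam B) (k + (- 'i) * e%:C)).
  have [e0 e0gt rho] := hk; split.
    apply: filterS2 (nbhs_right_gt 0) (nbhs_right_lt e0gt) => e egt elt.
    by have [h _] := rho e egt elt; exact: h.
  apply: filterS2 (nbhs_right_gt 0) (nbhs_right_lt e0gt) => e egt elt.
  by have [_ h] := rho e egt elt; rewrite mulNr; exact: h.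
have toN (T : Type) (G : R[i] -> T) :
    (fun e : R => G (k - 'i * e%:C)) = (fun e : R => G (k + (- 'i) * e%:C)).
  by apply/funext => e; rewrite mulNr.
have hP w v : S w -> S v ->
    cvg (('[resolvent (op_bdry Gam B) (k + 'i * e%:C) w, v] : R[i]^o)
           @[e --> 0^'+]).
  by move=> Sw Sv; have [h _] := h4 w v Sw Sv; exact: h.
have hN w v : S w -> S v ->
    cvg (('[resolvent (op_bdry Gam B) (k + (- 'i) * e%:C) w, v] : R[i]^o)
           @[e --> 0^'+]).
  move=> Sw Sv; have [_ h] := h4 w v Sw Sv.
  by move: h; rewrite (toN _ (fun z => '[resolvent (op_bdry Gam B) z w, v])).
have wP f rf := M_function_weak_cvg dAt hB rhoP h3 hP h2 (h1 f rf).
have wN f rf := M_function_weak_cvg dAt hB rhoN h3 hN h2 (h1 f rf).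
have MN f := toN _ (fun z => M_function Gam B z f).
split=> [f rf|f F u rf SF DF bF uE Su lims].
  by split; [exact: wP|rewrite MN; exact: wN].
have [g gP] := wP f rf.
have FF := @at_right_proper_filter R 0.
rewrite MN (weak_limE FF gP); apply/esym/(weak_limE FF).
move=> p; have [v [Sv Dv] <-] := h2 p I.
have SAv := h3 v Sv Dv.
rewrite uE in Su lims.
have cP := M_function_inner_cvg dAt hB rhoP h3 hP SF DF Su Sv Dv.
have cN := M_function_inner_cvg dAt hB rhoN h3 hN SF DF Su Sv Dv.
have limE w : S w -> _ := fun Sw => etrans (lims w Sw)
  (congr1 (fun G : R -> R[i]^o => lim (G e @[e --> 0^'+]))
    (toN _ (fun z =>
      '[resolvent (op_bdry Gam B) z (adjoint At F - k *: F), w] : R[i]^o))).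
rewrite (limE v Sv) (limE _ SAv) bF in cP; rewrite bF in cN.
by rewrite (cvg_unique (@norm_hausdorff _ R[i]^o) (gP (bdryt Gam B v)) cP).
Qed.
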